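(* Let $G=(V,E)$ be a finite undirected graph and $k$ a positive integer. Then \[ \mathcal{F}(G,k)\;\cong\; G^{\square k}/\pi, \] where $\pi$ is the equitable partition of $G^{\square k}$ whose cells are the orbits $\mathcal{O}_x=\{y\in V^k:\exists\sigma\in S_k,\ \sigma(x)=y\}$ of the symmetric group $S_k$ acting on $V^k$ by $\sigma(x_1,\dots,x_k)=(x_{\sigma(1)},\dots,x_{\sigma(k)})$. Moreover, if $G$ has perfect state transfer, then so does $\mathcal{F}(G,k)$, for every positive integer $k$.
   Context: Feder's secondary graph $\mathcal{F}(G,k)$ is the weighted graph whose vertices are the vectors $(n_u)_{u\in V}$ of nonnegative integers with $\sum_{u\in V}n_u=k$ (occupation numbers of $k$ bosons), where, for each edge $\{u,v\}$ of $G$ and each such vector $n$ with $n_u\ge1$, the vertex $n$ is joined to the vertex $n'$ obtained from $n$ by decreasing $n_u$ by one and increasing $n_v$ by one, with edge weight $\sqrt{n_u(n_v+1)}$. $G^{\square k}$ is the $k$-fold Cartesian product of $G$ (vertex set $V^k$, two $k$-tuples adjacent iff they differ in exactly one coordinate, in which the entries are adjacent in $G$). For an equitable partition $\pi=V_1\uplus\cdots\uplus V_m$ (each vertex of $V_j$ has exactly $d_{j,k}$ neighbours in $V_k$), the quotient $G/\pi$ is the weighted graph on the cells with adjacency matrix entries $\sqrt{d_{j,k}d_{k,j}}$. A weighted graph with adjacency matrix $A$ has perfect state transfer if there are vertices $u,v$ and a time $t$ with $|\langle v|e^{-itA}|u\rangle|=1$. *)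

(* Defs.v *)
From HB Require Import structures.
From mathcomp Require Import all_boot all_order all_algebra all_fingroup.
From mathcomp Require Import all_classical all_reals all_analysis.
Set Implicit Arguments. Unset Strict Implicit. Unset Printing Implicit Defensive.
Import Order.TTheory GRing.Theory Num.Theory numFieldNormedType.Exports.
Local Open Scope ring_scope.
Local Open Scope classical_set_scope.
Local Open Scope ring_scope.

Section Defs.
Variable R : realType.

(* A weighted graph on a finite vertex type T is given by its (real,
   symmetric) adjacency function A : T -> T -> R. *)

Fixpoint Apow (T : finType) (A : T -> T -> R) (m : nat) (x y : T) : R :=
  match m with
  | 0%N => (x == y)%:R
  | m'.+1 => \sum_(z : T) A x z * Apow A m' z y
  end.

(* e^{-itA} = \sum_m (-it)^m A^m / m!.  Since A is real, its entries split
   into a real part (even m, (-i)^(2j) = (-1)^j) and an imaginary part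
   (odd m, (-i)^(2j+1) = -(-1)^j i). *)
Definition expm_re_term (T : finType) (A : T -> T -> R) (t : R) (x y : T) (j : nat) : R :=
  (-1) ^+ j * t ^+ (2 * j) / ((2 * j)`!)%:R * Apow A (2 * j) x y.
Definition expm_im_term (T : finType) (A : T -> T -> R) (t : R) (x y : T) (j : nat) : R :=
  - ((-1) ^+ j * t ^+ (2 * j).+1 / ((2 * j).+1`!)%:R * Apow A (2 * j).+1 x y).

Definition expm_entry (T : finType) (A : T -> T -> R) (t : R) (v u : T) (a b : R) : Prop :=
  series (expm_re_term A t v u) @ \oo --> a /\
  series (expm_im_term A t v u) @ \oo --> b.

Definition has_PST (T : finType) (A : T -> T -> R) : Prop :=
  exists (u v : T) (t a b : R), u != v /\ expm_entry A t v u a b /\ a ^+ 2 + b ^+ 2 = 1.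

Definition wiso (T1 T2 : finType) (A1 : T1 -> T1 -> R) (A2 : T2 -> T2 -> R) : Prop :=
  exists f : T1 -> T2, bijective f /\ forall x y, A2 (f x) (f y) = A1 x y.

Definition adjR (T : finType) (e : rel T) : T -> T -> R := fun x y => (e x y)%:R.

(* occupation-number vectors (n_u)_u of nonnegative integers with sum k
   (each entry is then automatically <= k, so we store it in 'I_k.+1 to get
   a finite type; nothing is lost). *)
Definition occ (V : finType) (k : nat) :=
  {n : {ffun V -> 'I_k.+1} | (\sum_(u : V) (n u : nat))%N == k}.
Definition occn (V : finType) (k : nat) (n : occ V k) (u : V) : nat := val n u.

Definition moved (V : finType) (n n' : V -> nat) (u v : V) : bool :=
  [&& (1 <= n u)%N, n' u == (n u).-1, n' v == (n v).+1 &
      [forall w, (w != u) && (w != v) ==> (n' w == n w)]].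

Definition feder_adj (V : finType) (e : rel V) (k : nat) (n n' : occ V k) : R :=
  \sum_(p : V * V | e p.1 p.2 && moved (occn n) (occn n') p.1 p.2)
     Num.sqrt ((occn n p.1 * (occn n p.2).+1)%N%:R).

Definition cart_pow (V : finType) (e : rel V) (k : nat) : rel {ffun 'I_k -> V} :=
  fun x y => [exists i, e (x i) (y i) && [forall j, (j != i) ==> (x j == y j)]].

Definition Sk_act (V : finType) (k : nat) (s : 'S_k) (x : {ffun 'I_k -> V}) : {ffun 'I_k -> V} :=
  [ffun i => x (s i)].
Definition orbit_Sk (V : finType) (k : nat) (x : {ffun 'I_k -> V}) : {set {ffun 'I_k -> V}} :=
  [set y | [exists s : 'S_k, y == Sk_act s x]].
Definition Sk_orbit_partition (V : finType) (k : nat) : {set {set {ffun 'I_k -> V}}} :=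
  [set orbit_Sk x | x in [set: {ffun 'I_k -> V}]].

Definition nbrs_in (W : finType) (e : rel W) (x : W) (D : {set W}) : nat :=
  #|[set y in D | e x y]|.

Definition equitable (W : finType) (e : rel W) (P : {set {set W}}) : Prop :=
  finset.partition P [set: W] /\
  forall C D, C \in P -> D \in P -> forall x y, x \in C -> y \in C ->
    nbrs_in e x D = nbrs_in e y D.

Definition cells (W : finType) (P : {set {set W}}) := {C : {set W} | C \in P}.

(* d_{C,D}: number of neighbours in D of a (chosen) vertex of C; for an
   equitable partition this does not depend on the choice. *)
Definition dcell (W : finType) (e : rel W) (C D : {set W}) : nat :=
  if [pick x in C] is Some x then nbrs_in e x D else 0%N.

Definition quot_adj (W : finType) (e : rel W) (P : {set {set W}}) (C D : cells P) : R :=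
  Num.sqrt ((dcell e (val C) (val D) * dcell e (val D) (val C))%N%:R).

End Defs.

(* Main.v *)
(** Two k-tuples lie in the same S_k-orbit iff they have the same occupation
    numbers, so cells are occupation vectors.  A tuple with occupation n has
    exactly n_u neighbours obtained by moving a particle along the edge uv, and
    the reverse move has multiplicity n_v + 1; this gives the Feder weights.

    For state transfer, the cell of a constant tuple is a singleton, hence the
    walk on the quotient between such cells coincides with the walk on the
    Cartesian power between constant tuples.  If A = sum_j lam_j Q_j is the
    spectral decomposition of the adjacency matrix of G, then the tensor products
    of the Q_j, with eigenvalues the sums of the lam_j, decompose that of the
    power.  All exponential entries thus become finite sums of cosines and sines,
    and the amplitude from (u, .., u) to (v, .., v) is the k-th power of the
    amplitude from u to v. *)

Require Import Defs.
From HB Require Import structures.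
From mathcomp Require Import all_boot all_order all_algebra all_fingroup.
From mathcomp Require Import all_classical all_reals all_analysis.
From mathcomp Require Import spectral complex ring zify.
Set Implicit Arguments. Unset Strict Implicit. Unset Printing Implicit Defensive.
Import Order.TTheory GRing.Theory Num.Theory.
Import numFieldNormedType.Exports.
Local Open Scope ring_scope.

(** * Spectral decomposition and entries of the matrix exponential *)

Lemma complex_Re_realM (R : realType) (r : R) (z : R[i]) :
  complex.Re ((r%:C)%C * z) = r * complex.Re z.
Proof. by case: z => a b /=; rewrite mul0r subr0. Qed.

(* Real parts of the rank-one projections of the complex spectral theorem;
   taking real parts is harmless as [A] and its eigenvalues are real. *)
Lemma symmetric_spectral_decomposition (R : realType) (T : finType)
    (A : T -> T -> R) :
  (forall x y, A x y = A y x) ->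
  exists (d : nat) (lam : 'I_d -> R) (Q : 'I_d -> T -> T -> R),
    (forall x y, \sum_j Q j x y = (x == y)%:R) /\
    (forall j x y, \sum_w A x w * Q j w y = lam j * Q j x y).
Proof.
move=> A_sym; set n := #|T|.
pose M : 'M[R[i]]_n := \matrix_(a, b) (A (enum_val a) (enum_val b))%:C%C.
have M_herm : M \is hermsymmx.
  apply: realsym_hermsym.
    apply/is_hermitianmxP; rewrite expr0 scale1r map_mx_id //.
    by apply/matrixP => a b; rewrite !mxE A_sym.
  by apply/mxOverP => a b; rewrite mxE; apply/complex_realP; eexists.
have M_spec := orthomx_spectralP (hermitian_normalmx M_herm).
have lam_real := mxOverP (hermitian_spectral_diag_real M_herm).
move: M_spec lam_real (spectral_unit M).
set P := spectralmx M; set D := spectral_diag M => M_spec lam_real P_unit.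
exists n, (fun j => complex.Re (D ord0 j)), (fun j x y =>
  complex.Re (invmx P (enum_rank x) j * P j (enum_rank y))).
split=> [x y|j x y].
  have /matrixP/(_ (enum_rank x) (enum_rank y)) := mulVmx P_unit.
  rewrite !mxE => /(congr1 (@complex.Re R)).
  rewrite raddf_sum /= => ->.
  by rewrite (inj_eq enum_rank_inj); case: eqP.
(* The columns of [invmx P] are eigenvectors of [M]. *)
have /matrixP/(_ (enum_rank x) j) : M *m invmx P = invmx P *m diag_mx D.
  by rewrite {1}M_spec -!mulmxA mulmxV // mulmx1.
rewrite mul_mx_diag !mxE => /(congr1 (fun z => z * P j (enum_rank y))).
rewrite mulr_suml => /(congr1 (@complex.Re R)).
rewrite raddf_sum /= (reindex _ (onW_bij _ (enum_rank_bij T))) /= => H.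
transitivity (complex.Re (D ord0 j * (invmx P (enum_rank x) j * P j (enum_rank y)))).
  rewrite [X in complex.Re X](mulrCA) mulrA -H; apply: eq_bigr => w _.
  rewrite mxE !enum_rankK -mulrA.
  by rewrite complex_Re_realM.
have /complex_realP[r ->] := lam_real ord0 j.
by rewrite complex_Re_realM.
Qed.

(** Starting from the resolution of the identity, each further factor [A] multiplies the component
    [Q j] by [lam j]. *)
Lemma Apow_spectral (R : realType) (T J : finType) (A : T -> T -> R)
    (lam : J -> R) (Q : J -> T -> T -> R) :
  (forall x y, \sum_j Q j x y = (x == y)%:R) ->
  (forall j x y, \sum_w A x w * Q j w y = lam j * Q j x y) ->
  forall m x y, Apow A m x y = \sum_j lam j ^+ m * Q j x y.
Proof.
move=> Q_id Q_eig; elim=> [|m IHm] x y /=.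
  by rewrite -Q_id; apply: eq_bigr => j _; rewrite expr0 mul1r.
under eq_bigr do rewrite IHm mulr_sumr.
rewrite exchange_big /=; apply: eq_bigr => j _.
under eq_bigr do rewrite mulrCA.
by rewrite -mulr_sumr Q_eig mulrA exprSr.
Qed.

(** The even and odd parts of the exponential series become finite combinations of cosine and sine
    series, whose limits are known. The minus sign is that of [e^{-itA}]. *)
Lemma expm_entry_spectral (R : realType) (T J : finType) (A : T -> T -> R)
    (x y : T) (lam c : J -> R) (t : R) :
  (forall m, Apow A m x y = \sum_j lam j ^+ m * c j) ->
  expm_entry A t x y (\sum_j cos (t * lam j) * c j)
                     (- \sum_j sin (t * lam j) * c j).
Proof.
move=> A_spec; split.
  have -> : series (expm_re_term A t x y) =
      (fun n => \sum_j series (cos_coeff' (t * lam j)) n * c j).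
    apply/funext => n; rewrite /series /=.
    under [RHS]eq_bigr do rewrite mulr_suml.
    rewrite [RHS]exchange_big /=; apply: eq_bigr => i _.
    rewrite /expm_re_term A_spec mulr_sumr; apply: eq_bigr => j _.
    by rewrite /cos_coeff' -mul2n exprMn -exprnP; ring.
  apply: (@cvg_big R J +%R 0 xpredT (@add_continuous R)) => j _.
  apply: cvgMr_tmp; exact: cvg_cos_coeff'.
have -> : series (expm_im_term A t x y) =
    (fun n => - \sum_j series (sin_coeff' (t * lam j)) n * c j).
  apply/funext => n; rewrite /series /=.
  under [in RHS]eq_bigr do rewrite mulr_suml.
  rewrite [in RHS]exchange_big /= -sumrN; apply: eq_bigr => i _.
  rewrite /expm_im_term A_spec mulr_sumr; congr (- _); apply: eq_bigr => j _.
  by rewrite /sin_coeff' -mul2n exprMn -exprnP; ring.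
apply: cvgN; apply: (@cvg_big R J +%R 0 xpredT (@add_continuous R)) => j _.
apply: cvgMr_tmp; exact: cvg_sin_coeff'.
Qed.

Lemma expm_entry_unique (R : realType) (T : finType) (A : T -> T -> R)
    (t : R) (x y : T) (a b a' b' : R) :
  expm_entry A t x y a b -> expm_entry A t x y a' b' -> a = a' /\ b = b'.
Proof.
by move=> [ha hb] [ha' hb']; split; [move: ha ha'|move: hb hb'];
  exact: cvg_unique.
Qed.

(** * Amplitudes of tensor powers as complex numbers *)

(** The exponential [e^{ix}], which turns sums of eigenvalues into products. *)
Definition cis {R : realType} (x : R) : R[i] := (cos x +i* sin x)%C.

Lemma cisD {R : realType} (x y : R) : cis (x + y) = cis x * cis y.
Proof. by rewrite /cis cosD sinD; congr (_ +i* _)%C; rewrite addrC mulrC. Qed.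

Lemma cis_sum (R : realType) (I : finType) (F : I -> R) :
  cis (\sum_i F i) = \prod_i cis (F i).
Proof. by apply: big_morph; [exact: cisD | rewrite /cis cos0 sin0]. Qed.

Lemma sum_cis (R : realType) (J : finType) (th c : J -> R) :
  \sum_j cis (th j) * (c j)%:C%C =
  ((\sum_j cos (th j) * c j) +i* (\sum_j sin (th j) * c j))%C.
Proof.
apply/eqP; rewrite eq_complex !raddf_sum /=.
by apply/andP; split; apply/eqP; apply: eq_bigr => j _; rewrite mulr0 ?subr0 ?add0r.
Qed.

(* Both sides are the squared modulus of [(\sum_j c_j e^{i t lam_j})^k]. *)
Lemma sqr_modulus_tensor (R : realType) (J : finType) (lam c : J -> R) (t : R)
    (k : nat) :
  let s (f : {ffun 'I_k -> J}) := \sum_i lam (f i) in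
  let p (f : {ffun 'I_k -> J}) := \prod_i c (f i) in
  (\sum_f cos (t * s f) * p f) ^+ 2 + (\sum_f sin (t * s f) * p f) ^+ 2 =
  ((\sum_j cos (t * lam j) * c j) ^+ 2 + (\sum_j sin (t * lam j) * c j) ^+ 2) ^+ k.
Proof.
move=> s p; apply: complexI.
have H (I : finType) (th d : I -> R) :
    (((\sum_j cos (th j) * d j) ^+ 2 + (\sum_j sin (th j) * d j) ^+ 2)%:C)%C =
    `|\sum_j cis (th j) * (d j)%:C%C| ^+ 2.
  by rewrite sum_cis -add_Re2_Im2.
rewrite rmorphXn [LHS]H [X in _ = X ^+ k]H -exprM mulnC exprM -[X in _ = X ^+ 2]normrX.
suff -> : \sum_f cis (t * s f) * (p f)%:C%C =
    (\sum_j cis (t * lam j) * (c j)%:C%C) ^+ k by [].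
(* The [k]-th power of a sum over [J] expands into a sum over all [f] from ['I_k] to [J]. *)
rewrite -[k in RHS]card_ord -prodr_const bigA_distr_bigA /=.
apply: eq_bigr => f _; rewrite big_split /= -cis_sum -mulr_sumr.
by rewrite rmorph_prod.
Qed.

(** * Walks on quotients by equitable partitions *)

Section EquitableQuotient.
Variables (R : realType) (W : finType) (e : rel W) (P : {set {set W}}).
Hypotheses (e_sym : symmetric e) (P_equitable : equitable e P).

Lemma nbrs_inE (x : W) (D : {set W}) : nbrs_in e x D = (\sum_(y in D) e x y)%N.
Proof.
rewrite /nbrs_in -sum1_card big_mkcond [RHS]big_mkcond /=.
apply: eq_bigr => y _; rewrite inE. by case: (y \in D); case: (e x y).
Qed.

Lemma dcellE (C D : {set W}) (x : W) :
  C \in P -> D \in P -> x \in C -> dcell e C D = nbrs_in e x D.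
Proof.
move=> CP DP xC; rewrite /dcell; case: pickP => [y yC|/(_ x)]; last by rewrite xC.
by case: P_equitable => _ H; apply: (H C).
Qed.

(** Both sides count the adjacent pairs in [C] times [D], grouped by first or by second
    component. *)
Lemma dcell_double_count (C D : {set W}) : C \in P -> D \in P ->
  (#|C| * dcell e C D = #|D| * dcell e D C)%N.
Proof.
have H (E F : {set W}) : E \in P -> F \in P ->
    (#|E| * dcell e E F = \sum_(x in E) \sum_(y in F) e x y)%N.
  move=> EP FP; rewrite -sum_nat_const; apply: eq_bigr => x xE.
  by rewrite (dcellE EP FP xE) nbrs_inE.
move=> CP DP; rewrite !H // exchange_big /=.
by apply: eq_bigr => y _; apply: eq_bigr => x _; rewrite e_sym.
Qed.

(** Double counting gives [d_CD d_DC |D| = |C| d_CD^2]; take square roots. *)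
Lemma quot_adj_sqrt_card (C D : cells P) :
  quot_adj R e C D * Num.sqrt #|val D|%:R =
  Num.sqrt #|val C|%:R * (dcell e (val C) (val D))%:R.
Proof.
rewrite -sqrtrM ?ler0n // -natrM -mulnA [(_ * #|_|)%N]mulnC.
rewrite -(dcell_double_count (valP C) (valP D)) mulnCA natrM sqrtrM ?ler0n //.
by rewrite mulnn natrX sqrtr_sqr ger0_norm // ler0n.
Qed.

(* The normalized indicators of the cells span a subspace invariant under the
   adjacency operator, on which it acts as the quotient. *)
Lemma Apow_quot (m : nat) (C D : cells P) (x : W) : x \in val C ->
  Num.sqrt #|val D|%:R * Apow (@quot_adj R W e P) m C D =
  Num.sqrt #|val C|%:R * \sum_(y in val D) Apow (@adjR R W e) m x y.
Proof.
have [/and3P[_ P_triv P_ne0] _] := P_equitable.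
elim: m C x => [|m IHm] C x xC.
  rewrite /=; case: (eqVneq C D) => [<-|CD].
    rewrite (bigD1 x) //= eqxx big1 ?addr0 // => y /andP[_].
    by rewrite eq_sym => /negPf->.
  rewrite mulr0 big1 ?mulr0 // => y yD; case: eqP => // xy; subst y.
  case/negP: CD; apply/eqP; apply: val_inj.
  by rewrite -(def_pblock P_triv (valP C) xC) (def_pblock P_triv (valP D) yD).
rewrite /= exchange_big /= mulr_sumr.
under [in RHS]eq_bigr do rewrite -mulr_sumr.
set S := fun z => \sum_(y in val D) Apow (@adjR R W e) m z y.
have -> : \sum_z adjR R e x z * S z =
    \sum_(E : cells P) \sum_(z in val E) adjR R e x z * S z.
  rewrite -(big_sub P (fun E : {set W} => \sum_(z in E) adjR R e x z * S z)).
  rewrite -(set_partition_big P (D := [set: W])); last by case: P_equitable.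
  by apply: eq_bigl => z; rewrite inE.
rewrite mulr_sumr; apply: eq_bigr => E _.
have /finset.set0Pn[z0 z0E] : val E != finset.set0.
  by apply/eqP => E0; move: (valP E); rewrite E0 (negPf P_ne0).
(* The induction hypothesis expresses [sqrt #|E| * S z] independently of [z], and the root is
   nonzero as [E] is nonempty. *)
have S_const z : z \in val E -> S z = S z0.
  have E_gt0 : Num.sqrt #|val E|%:R != 0 :> R.
    by rewrite gt_eqF // sqrtr_gt0 ltr0n; apply/card_gt0P; exists z0.
  by move=> zE; apply: (mulfI E_gt0); rewrite -!IHm.
transitivity (quot_adj R e C E * (Num.sqrt #|val E|%:R * S z0)).
  by rewrite -(IHm _ _ z0E) mulrCA.
rewrite mulrA quot_adj_sqrt_card -mulrA; congr (_ * _).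
rewrite (dcellE (valP C) (valP E) xC) nbrs_inE natr_sum mulr_suml.
by apply: eq_bigr => z zE; rewrite (S_const z zE).
Qed.

End EquitableQuotient.

(** * Transport along weighted isomorphisms *)

Lemma wiso_Apow (R : realType) (T1 T2 : finType) (A1 : T1 -> T1 -> R)
    (A2 : T2 -> T2 -> R) (f : T1 -> T2) :
  bijective f -> (forall x y, A2 (f x) (f y) = A1 x y) ->
  forall m x y, Apow A2 m (f x) (f y) = Apow A1 m x y.
Proof.
move=> f_bij fA; elim=> [|m IHm] x y /=; first by rewrite (inj_eq (bij_inj f_bij)).
rewrite (reindex f) /=; last exact: onW_bij.
by apply: eq_bigr => z _; rewrite fA IHm.
Qed.

Lemma expm_entry_Apow (R : realType) (T1 T2 : finType) (A1 : T1 -> T1 -> R)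
    (A2 : T2 -> T2 -> R) (x1 y1 : T1) (x2 y2 : T2) (t a b : R) :
  (forall m, Apow A1 m x1 y1 = Apow A2 m x2 y2) ->
  expm_entry A1 t x1 y1 a b -> expm_entry A2 t x2 y2 a b.
Proof.
move=> A12 [ha hb]; split.
  rewrite (_ : expm_re_term A2 t x2 y2 = expm_re_term A1 t x1 y1) //.
  by apply/funext => j; rewrite /expm_re_term A12.
rewrite (_ : expm_im_term A2 t x2 y2 = expm_im_term A1 t x1 y1) //.
by apply/funext => j; rewrite /expm_im_term A12.
Qed.

Lemma wiso_PST (R : realType) (T1 T2 : finType) (A1 : T1 -> T1 -> R)
    (A2 : T2 -> T2 -> R) : wiso A1 A2 -> has_PST A2 -> has_PST A1.
Proof.
move=> [f [f_bij fA]]; have [g fK gK] := f_bij.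
move=> [u [v [t [a [b [uv [entry ab]]]]]]]; exists (g u), (g v), t, a, b.
rewrite (inj_eq (can_inj gK)); do 2 split => //.
apply: expm_entry_Apow entry => m.
by rewrite -(wiso_Apow f_bij fA) !gK.
Qed.

(** * Occupation numbers and orbits of tuples *)

Section Occupation.
Variables (V : finType) (k : nat).
Implicit Types (x y : {ffun 'I_k -> V}) (n : occ V k).

Lemma card_fiber_lt x u : (#|[set i | x i == u]%SET| < k.+1)%N.
Proof. by rewrite ltnS -[leqRHS]card_ord max_card. Qed.

Lemma sum_card_fiber x :
  (\sum_(u : V) ([ffun u => Ordinal (card_fiber_lt x u)] u : nat) == k)%N.
Proof.
rewrite -[X in _ == X]card_ord -sum1_card (partition_big x xpredT) //=.
apply/eqP/eq_bigr => u _; rewrite ffunE /= -sum1_card.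
by apply: eq_bigl => i; rewrite inE.
Qed.

Definition occ_of x : occ V k := 
  exist (fun n : {ffun V -> 'I_k.+1} => \sum_(u : V) (n u : nat) == k)%N _
    (sum_card_fiber x).

Lemma occn_of x u : occn (occ_of x) u = #|[set i | x i == u]%SET|.
Proof. by rewrite /occn /= ffunE. Qed.

Lemma occn_inj n n' : occn n =1 occn n' -> n = n'.
Proof. by move=> nn'; apply/val_inj/ffunP => u; apply/val_inj/nn'. Qed.

(** Reads occupation numbers as multiplicities in a list, so that [perm_eq] applies. *)
Lemma count_mem_tuple x u : count_mem u [tuple x i | i < k] = occn (occ_of x) u.
Proof.
rewrite occn_of /= count_map -sum1_count big_enum_cond /= -sum1_card.
by apply: eq_bigl => i; rewrite !inE.
Qed.

Lemma occ_of_act (s : 'S_k) x : occ_of (Sk_act s x) = occ_of x.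
Proof.
apply: occn_inj => u; rewrite !occn_of -[RHS](card_preimset _ (@perm_inj _ s)).
by apply: eq_card => i; rewrite !inE ffunE.
Qed.

(** Tuples with equal multiplicities are rearrangements of each other, and [tuple_permP] supplies
    the permutation of the coordinates. *)
Lemma mem_orbit_Sk x y : (y \in orbit_Sk x) = (occ_of x == occ_of y).
Proof.
rewrite inE; apply/existsP/eqP => [[s /eqP->]|xy]; first by rewrite occ_of_act.
have /tuple_permP[s ys] : perm_eq [tuple y i | i < k] [tuple x i | i < k].
  by apply/allP => u _ /=; rewrite !count_mem_tuple xy.
exists s; apply/eqP/ffunP => i; rewrite ffunE.
have /(congr1 (fun r => tnth r i)) := val_inj ys.
by rewrite !tnth_mktuple.
Qed.

Lemma orbit_Sk_eqP x y : reflect (orbit_Sk x = orbit_Sk y) (occ_of x == occ_of y).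
Proof.
apply: (iffP eqP) => [xy|xy]; first by apply/setP => z; rewrite !mem_orbit_Sk xy.
by apply/eqP; rewrite -mem_orbit_Sk xy mem_orbit_Sk.
Qed.

(** List each [u] exactly [n_u] times; the total length is [k]. *)
Lemma occ_of_surj n : exists x, occ_of x = n.
Proof.
pose s := flatten [seq nseq (occn n u) u | u <- enum V].
have s_count u : count_mem u s = occn n u.
  rewrite count_flatten -map_comp sumnE big_map big_enum /= (bigD1 u) //=.
  rewrite count_nseq /= eqxx mul1n big1 ?addn0 // => v vu.
  by rewrite count_nseq /= (negPf vu).
have s_size : size s == k.
  rewrite size_flatten /shape -map_comp sumnE big_map big_enum /=.
  by apply/eqP; rewrite -[RHS](eqP (valP n)); apply: eq_bigr => u _; rewrite size_nseq.
pose x : {ffun 'I_k -> V} := [ffun i => tnth (Tuple s_size) i].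
exists x; apply: occn_inj => u; rewrite -count_mem_tuple -s_count.
congr (count_mem u _); rewrite -[RHS]/(val (Tuple s_size)); congr val.
by apply: eq_from_tnth => i; rewrite tnth_mktuple ffunE.
Qed.

(** Orbits are the fibres of [occ_of], hence form a partition. *)
Lemma Sk_orbit_partitionE :
  Sk_orbit_partition V k = preim_partition occ_of [set: {ffun 'I_k -> V}].
Proof.
have class_eq x : [set y in [set: {ffun 'I_k -> V}] | occ_of x == occ_of y]%SET =
    orbit_Sk x by apply/setP => y; rewrite mem_orbit_Sk !inE.
apply/setP => C; apply/imsetP/imsetP => -[x _ ->]; exists x;
  by rewrite ?class_eq ?classical_sets.in_setT ?finset.in_setT.
Qed.

Lemma orbit_Sk_in_partition x : orbit_Sk x \in Sk_orbit_partition V k.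
Proof. by apply/imsetP; exists x; rewrite ?classical_sets.in_setT. Qed.

Definition orbit_cell x : cells (Sk_orbit_partition V k) :=
  exist (fun C : {set _} => C \in Sk_orbit_partition V k) _
    (orbit_Sk_in_partition x).

Lemma orbit_Sk_const u : orbit_Sk [ffun=> u] = [set [ffun=> u] : {ffun 'I_k -> V}]%SET.
Proof.
apply/setP => y; rewrite !inE; apply/existsP/eqP => [[s /eqP->]|->].
  by apply/ffunP => i; rewrite !ffunE.
by exists 1%g; apply/eqP/ffunP => i; rewrite !ffunE.
Qed.

End Occupation.

(** * Permutations as automorphisms of the Cartesian power *)

Lemma cart_pow_sym (V : finType) (e : rel V) (k : nat) :
  symmetric e -> symmetric (@cart_pow V e k).
Proof.
move=> e_sym x y; apply/existsP/existsP => -[i /andP[exy /forallP xy]];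
  by exists i; rewrite e_sym exy; apply/forallP => j;
     have := xy j; rewrite (eq_sym (y j)).
Qed.

Lemma Sk_act_inj (V : finType) (k : nat) (s : 'S_k) : injective (@Sk_act V k s).
Proof.
move=> x y /ffunP xy; apply/ffunP => i.
by have := xy (s^-1 i)%g; rewrite !ffunE permKV.
Qed.

Lemma cart_pow_act (V : finType) (e : rel V) (k : nat) (s : 'S_k) x y :
  cart_pow e (Sk_act s x) (Sk_act s y) = @cart_pow V e k x y.
Proof.
apply/existsP/existsP => -[i /andP[]]; rewrite ?ffunE => exy /forallP xy.
  exists (s i); rewrite exy; apply/forallP => j; apply/implyP => ji.
  have := xy (s^-1 j)%g; rewrite !ffunE permKV => /implyP; apply.
  by apply: contra ji => /eqP<-; rewrite permKV.
exists (s^-1 i)%g; rewrite !ffunE permKV exy; apply/forallP => j; apply/implyP => ji.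
rewrite !ffunE; have /implyP := xy (s j); apply.
by apply: contra ji => /eqP<-; rewrite permK.
Qed.

(** If [y] is the image of [x] under [s], the automorphism given by [s] preserves the cell [D] and
    matches the neighbours of [x] in [D] with those of [y]. *)
Lemma equitable_Sk_orbits (V : finType) (e : rel V) (k : nat) :
  equitable (@cart_pow V e k) (Sk_orbit_partition V k).
Proof.
split; first by rewrite Sk_orbit_partitionE; exact: preim_partitionP.
move=> C D /imsetP[c _ ->] /imsetP[d _ ->] x y.
rewrite !mem_orbit_Sk => /eqP cx /eqP cy.
have : y \in orbit_Sk x by rewrite mem_orbit_Sk -cx cy.
rewrite inE => /existsP[s /eqP->].
have D_act z : (Sk_act s z \in orbit_Sk d) = (z \in orbit_Sk d).
  by rewrite !mem_orbit_Sk occ_of_act.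
move: (orbit_Sk d) D_act => {}D D_act.
rewrite /nbrs_in -[RHS](card_preimset _ (@Sk_act_inj V k s)).
by apply: eq_card => z; rewrite !inE D_act cart_pow_act.
Qed.

(** * Single-particle moves *)

Section Moves.
Variables (V : finType) (n n' : V -> nat).

(** Only at [u] does the occupation drop and only at [v] does it rise. On a loopless graph, the sum
    in [feder_adj] thus has at most one term. *)
Lemma moved_inj u v u' v' : u != v -> u' != v' ->
  moved n n' u v -> moved n n' u' v' -> u = u' /\ v = v'.
Proof.
move=> uv uv' /and4P[nu /eqP n'u /eqP n'v /forallP nE].
move=> /and4P[nu' /eqP n'u' /eqP n'v' /forallP nE'].
split; apply/eqP; apply: contraTT isT => neq.
  have := nE u'; rewrite (eq_sym u') neq /= n'u'.
  case: (eqVneq u' v) => [u'v|_ /= /eqP]; last by lia.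
  by move: n'u'; rewrite u'v n'v; lia.
have := nE v'; rewrite (eq_sym v' v) neq andbT n'v'.
case: (eqVneq v' u) => [v'u|_ /= /eqP]; last by lia.
by move: n'v'; rewrite v'u n'u; lia.
Qed.

Lemma moved_sym u v : u != v -> moved n n' u v -> moved n' n v u.
Proof.
move=> uv /and4P[nu /eqP n'u /eqP n'v /forallP nE].
apply/and4P; split; rewrite ?n'u ?n'v ?prednK //.
by apply/forallP => w; rewrite andbC (eq_sym (n w)).
Qed.

End Moves.

Lemma moved_functional (V : finType) (n n' n'' : V -> nat) u v :
  moved n n' u v -> moved n n'' u v -> n' =1 n''.
Proof.
move=> /and4P[_ /eqP n'u /eqP n'v /forallP nE].
move=> /and4P[_ /eqP n''u /eqP n''v /forallP nE''] w.
case: (eqVneq w u) => [->|wu]; first by rewrite n'u n''u.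
case: (eqVneq w v) => [->|wv]; first by rewrite n'v n''v.
by have := nE w; have := nE'' w; rewrite wu wv => /eqP-> /eqP->.
Qed.

(** * Neighbours in the Cartesian power *)

Section CartesianPower.
Variables (V : finType) (e : rel V) (k : nat).
Hypothesis e_irr : irreflexive e.
Implicit Types (x y z : {ffun 'I_k -> V}).

Definition update x (i : 'I_k) (w : V) : {ffun 'I_k -> V} :=
  [ffun j => if j == i then w else x j].

(** Each neighbour of [x] arises from exactly one pair [(i, w)]: without loops, the new value at [i]
    differs from [x i], so [i] can be recovered. The general operation serves both counting and real
    sums. *)
Lemma big_cart_pow (S : Type) (idx : S) (op : Monoid.com_law idx) x
    (h : {ffun 'I_k -> V} -> S) :
  \big[op/idx]_(z | cart_pow e x z) h z =
  \big[op/idx]_i \big[op/idx]_(w | e (x i) w) h (update x i w).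
Proof.
rewrite pair_big_dep /=.
rewrite -(@big_imset _ _ _ _ _ (fun p => update x p.1 p.2)
  [pred p : 'I_k * V | e (x p.1) p.2] h) /=.
  apply: eq_bigl => z; apply/existsP/imsetP => [[i /andP[exz /forallP xz]]|[[i w]]].
    exists (i, z i) => //; apply/ffunP => j; rewrite ffunE /=.
    by case: (eqVneq j i) => [->|ji] //; have := xz j; rewrite ji => /eqP.
  rewrite inE /= => exw ->; exists i; rewrite ffunE eqxx exw.
  by apply/forallP => j; rewrite ffunE; case: (j == i); rewrite /= ?eqxx.
move=> [i w] [j w'] /=; rewrite !inE /= => exw exw' /ffunP H.
have ij : i = j.
  apply/eqP; apply: contraTT exw => ij; have := H i; rewrite !ffunE eqxx (negPf ij).
  by move=> ->; rewrite e_irr.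
by subst j; have := H i; rewrite !ffunE eqxx => ->.
Qed.

Lemma moved_update x i w : x i != w ->
  moved (occn (occ_of x)) (occn (occ_of (update x i w))) (x i) w.
Proof.
move=> xw; apply/and4P; rewrite !occn_of; split.
- by apply/card_gt0P; exists i; rewrite inE.
- rewrite [in X in _ == X](cardsD1 i) inE eqxx /=; apply/eqP/eq_card => j.
  by rewrite !inE ffunE; case: (j == i); rewrite // eq_sym (negPf xw).
- rewrite (cardsD1 i) inE ffunE !eqxx /= add1n eqSS; apply/eqP/eq_card => j.
  rewrite !inE ffunE; case: (eqVneq j i) => [->|//]; by rewrite (negPf xw).
apply/forallP => u; apply/implyP => /andP[ux uw]; rewrite !occn_of.
apply/eqP/eq_card => j; rewrite !inE ffunE; case: (eqVneq j i) => [->|//].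
by rewrite eq_sym (negPf uw) eq_sym (negPf ux).
Qed.

Lemma occ_of_update x i w (n : occ V k) : e (x i) w ->
  (n == occ_of (update x i w)) = moved (occn (occ_of x)) (occn n) (x i) w.
Proof.
move=> exw; have xw : x i != w by apply: contraTneq exw => ->; rewrite e_irr.
have mv := moved_update xw.
apply/eqP/idP => [->//|mv']; exact/occn_inj/(moved_functional mv').
Qed.

Lemma nbrs_in_orbit x y :
  nbrs_in (@cart_pow V e k) x (orbit_Sk y) =
  (\sum_(p : V * V | e p.1 p.2 && moved (occn (occ_of x)) (occn (occ_of y)) p.1 p.2)
     occn (occ_of x) p.1)%N.
Proof.
rewrite /nbrs_in -sum1_card.
rewrite (eq_bigl (fun z => cart_pow e x z && (z \in orbit_Sk y))); last first.
  by move=> z; rewrite inE andbC.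
rewrite big_mkcondr big_cart_pow /=.
under eq_bigr => i _ do under eq_bigr => w exw do
  rewrite mem_orbit_Sk (occ_of_update _ exw).
(* Group the coordinates [i] by their value [u = x i]: each of the [n_u] coordinates in a group
   admits the same moves. *)
rewrite (partition_big x xpredT) //= -(pair_big_dep xpredT
  (fun u w => e u w && moved (occn (occ_of x)) (occn (occ_of y)) u w)
  (fun u _ => occn (occ_of x) u)) /=.
apply: eq_bigr => u _; rewrite sum_nat_const.
under eq_bigr => i /eqP-> do rewrite -big_mkcondr sum1_card.
rewrite sum_nat_const occn_of mulnC; congr (_ * _)%N.
by apply: eq_card => i; rewrite !inE.
Qed.

Lemma sum_cart_pow (R : realType) x (h : {ffun 'I_k -> V} -> R) :
  \sum_z adjR R (@cart_pow V e k) x z * h z =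
  \sum_i \sum_w adjR R e (x i) w * h (update x i w).
Proof.
transitivity (\sum_(z | cart_pow e x z) h z).
  rewrite [RHS]big_mkcond; apply: eq_bigr => z _.
  by rewrite /adjR; case: cart_pow; rewrite ?mul1r ?mul0r.
rewrite big_cart_pow; apply: eq_bigr => i _; rewrite big_mkcond.
by apply: eq_bigr => w _; rewrite /adjR; case: e; rewrite ?mul1r ?mul0r.
Qed.

End CartesianPower.

(** * The isomorphism with the orbit quotient *)

Lemma wiso_feder_quotient (R : realType) (V : finType) (e : rel V) (k : nat) :
  symmetric e -> irreflexive e ->
  wiso (@feder_adj R V e k)
       (@quot_adj R _ (@cart_pow V e k) (Sk_orbit_partition V k)).
Proof.
move=> e_sym e_irr; pose x n := sval (cid (@occ_of_surj V k n)).
have xK n : occ_of (x n) = n by exact: (svalP (cid (occ_of_surj n))).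
exists (fun n => orbit_cell (x n)); split.
  have C_ne0 (C : cells (Sk_orbit_partition V k)) : exists y, val C == orbit_Sk y.
    by have /imsetP[y _ Cy] := valP C; exists y; apply/eqP.
  exists (fun C => occ_of (xchoose (C_ne0 C))) => [n|C].
    have /eqP := xchooseP (C_ne0 (orbit_cell (x n))).
    by move/orbit_Sk_eqP/eqP; rewrite xK.
  apply: val_inj; rewrite [RHS](eqP (xchooseP (C_ne0 C))) /=.
  by apply/orbit_Sk_eqP; rewrite xK.
have x_orbit n : x n \in orbit_Sk (x n) by rewrite mem_orbit_Sk.
have equit := @equitable_Sk_orbits V e k.
move=> n n'; rewrite /quot_adj /=.
rewrite !(dcellE equit (orbit_Sk_in_partition _) (orbit_Sk_in_partition _) (x_orbit _)).
rewrite !nbrs_in_orbit // !xK /feder_adj.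
have e_neq u v : e u v -> u != v by apply: contraTneq => ->; rewrite e_irr.
pose moves (m m' : occ V k) :=
  [pred p : V * V | e p.1 p.2 && moved (occn m) (occn m') p.1 p.2].
(* Without a move both weights vanish; otherwise the move is unique and each neighbour count reduces
   to one term. *)
case: (pickP (moves n n')) => [[u v] /andP[/= euv mv]|no_move]; last first.
  by rewrite !(big_pred0 _ _ _ _ no_move) mul0n sqrtr0.
have unique (m m' : occ V k) (a b : V) : e a b -> moved (occn m) (occn m') a b ->
    moves m m' =1 pred1 (a, b).
  move=> eab ab [c d] /=; apply/andP/eqP => [[/= ecd cd]|[-> ->]//].
  by have [-> ->] := moved_inj (e_neq _ _ eab) (e_neq _ _ ecd) ab cd.
have evu : e v u by rewrite e_sym.
rewrite !(big_pred1 _ (unique _ _ _ _ euv mv)).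
rewrite (big_pred1 _ (unique _ _ _ _ evu (moved_sym (e_neq _ _ euv) mv))) /=.
(* The reverse count is the occupation of [v] after the move, that is [n_v + 1]. *)
by have /and4P[_ _ /eqP-> _] := mv.
Qed.

(** * Spectral decomposition of the Cartesian power *)

Section TensorSpectral.
Variables (R : realType) (V J : finType) (e : rel V) (k : nat).
Variables (lam : J -> R) (Q : J -> V -> V -> R).
Hypothesis e_irr : irreflexive e.
Hypothesis Q_id : forall x y, \sum_j Q j x y = (x == y)%:R.
Hypothesis Q_eig : forall j x y, \sum_w adjR R e x w * Q j w y = lam j * Q j x y.

Lemma Apow_cart_pow_spectral m (x y : {ffun 'I_k -> V}) :
  Apow (adjR R (@cart_pow V e k)) m x y =
  \sum_(f : {ffun 'I_k -> J})
     (\sum_i lam (f i)) ^+ m * \prod_i Q (f i) (x i) (y i).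
Proof.
pose lam_k (f : {ffun 'I_k -> J}) := \sum_i lam (f i).
pose Q_k (f : {ffun 'I_k -> J}) (x y : {ffun 'I_k -> V}) :=
  \prod_i Q (f i) (x i) (y i).
apply: (@Apow_spectral R _ _ _ lam_k Q_k) => {m x y} [x y|f x y]; rewrite /Q_k.
  rewrite -(bigA_distr_bigA (fun i j => Q j (x i) (y i))) /=.
  under eq_bigr do rewrite Q_id.
  case: (eqVneq x y) => [->|]; first by rewrite big1 // => i _; rewrite eqxx.
  move=> xy; have [i xyi] : exists i, x i != y i.
    apply/existsP; apply: contraNT xy; rewrite negb_exists => /forallP xy.
    by apply/eqP/ffunP => i; apply/eqP; have := xy i; rewrite negbK.
  by rewrite (bigD1 i) //= (negPf xyi) mul0r.
(* The adjacency operator is a sum over coordinates; its [i]-th summand affects only the factor at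
   [i], where it contributes [lam (f i)]. *)
rewrite sum_cart_pow // mulr_suml; apply: eq_bigr => i _.
rewrite [in RHS](bigD1 i) //= mulrA -Q_eig mulr_suml.
apply: eq_bigr => w _; rewrite -mulrA; congr (_ * _).
rewrite (bigD1 i) //= ffunE eqxx; congr (_ * _); apply: eq_bigr => j ji.
by rewrite ffunE (negPf ji).
Qed.

End TensorSpectral.

(** * Perfect state transfer *)

Lemma PST_Sk_quotient (R : realType) (V : finType) (e : rel V) (k : nat) :
  symmetric e -> irreflexive e -> (0 < k)%N -> has_PST (@adjR R V e) ->
  has_PST (@quot_adj R _ (@cart_pow V e k) (Sk_orbit_partition V k)).
Proof.
move=> e_sym e_irr k_gt0 [u [v [t [a [b [uv [entry ab]]]]]]].
have [|d [lam [Q [Q_id Q_eig]]]] := @symmetric_spectral_decomposition R V (adjR R e).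
  by move=> x y; rewrite /adjR e_sym.
have A_spec m := Apow_spectral Q_id Q_eig m v u.
have [a_eq b_eq] := expm_entry_unique entry (expm_entry_spectral t A_spec).
pose const w : {ffun 'I_k -> V} := [ffun=> w].
pose cell w := orbit_cell (const w).
pose s (f : {ffun 'I_k -> 'I_d}) := \sum_i lam (f i).
pose p (f : {ffun 'I_k -> 'I_d}) := \prod_i Q (f i) v u.
exists (cell u), (cell v), t, (\sum_f cos (t * s f) * p f),
  (- \sum_f sin (t * s f) * p f); split; last split.
- apply: contraNneq uv => /(congr1 val) /=; rewrite !orbit_Sk_const.
  (* Equal constant tuples agree at coordinate 0, which exists as [k] is positive. *)
  move=> /set1_inj /ffunP/(_ (Ordinal k_gt0)); rewrite !ffunE => ->; exact: eqxx.
- apply: expm_entry_spectral => m.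
  transitivity (Apow (adjR R (@cart_pow V e k)) m (const v) (const u)); last first.
    rewrite (Apow_cart_pow_spectral e_irr Q_id Q_eig); apply: eq_bigr => f _.
    by congr (_ * _); apply: eq_bigr => i _; rewrite !ffunE.
  (* Both cells are singletons: the normalizing roots are 1 and the sum over the cell has one
     term. *)
  have := @Apow_quot R _ _ _ (cart_pow_sym e_sym) (@equitable_Sk_orbits V e k)
    m (cell v) (cell u) (const v).
  rewrite /= !orbit_Sk_const !cards1 !sqrtr1 !mul1r big_set1; apply.
  by rewrite inE.
- have norm_k := sqr_modulus_tensor lam (fun j => Q j v u) t k.
  by rewrite sqrrN [LHS]norm_k -(sqrrN (\sum_j sin _ * _)) -a_eq -b_eq ab expr1n.
Qed.

Theorem theorem3 (R : realType) (V : finType) (e : rel V)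
    (e_sym : symmetric e) (e_irr : irreflexive e) (k : nat) (k_pos : (0 < k)%N) :
  equitable (@cart_pow V e k) (Sk_orbit_partition V k) /\
  wiso (@feder_adj R V e k) (@quot_adj R _ (@cart_pow V e k) (Sk_orbit_partition V k)) /\
  (has_PST (@adjR R V e) -> has_PST (@feder_adj R V e k)).
Proof.
have iso := @wiso_feder_quotient R V e k e_sym e_irr.
split; first exact: equitable_Sk_orbits.
by split=> // /(PST_Sk_quotient e_sym e_irr k_pos)/(wiso_PST iso).
Qed.
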